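(* Let $k$ be an algebraically closed field and let $G={\rm Spec}\,A$ be a (linearly) semisimple affine $k$-group with Fourier transform $F_G$. Then for all $a\in A$ and all points $g\in G$, $$a(g)=a^*(g^* )=\big(F_{\hat G}(F_G(a))\big)(g^* )=\int_{\hat G}F_G(a)^*\cdot g^*=\int_{\hat G}F_G(a)_i\cdot(g^i_{rs})\,d\rho_i .$$
   Context: An affine $k$-group $G={\rm Spec}\,A$ is called (linearly) semisimple if every linear representation of $G$ is completely reducible. $A^*={\rm Hom}_k(A,k)$ is a $k$-algebra with the product dual to the comultiplication of $A$. Points $g\in G$ (with values in any commutative $k$-algebra $B$) are viewed as elements of ${\rm Hom}_k(A,B)$, and formulas are understood after extension of scalars to $B$. Let $\hat G$ be the set of irreducible linear representations $\rho_i\colon G\to{\rm End}_k(E_i)$ (up to isomorphism); then $A^*=\prod_{\rho_i\in\hat G}{\rm End}_k(E_i)$ and $\tilde A:=\bigoplus_i{\rm End}_k(E_i)\subseteq A^*$. For $g\in G$, $(g^i_{rs})=\rho_i(g)$ is the $i$-th component of $g$. The invariant integral $w_G\in A^*$ is the unique $G$-invariant linear form on $A$ with $w_G(1)=1$. The map $*\colon A\to A$, $a\mapsto a^*$, is induced by $g\mapsto g^{-1}$, and $*\colon A^*\to A^*$ is its transpose, so $g^*=g^{-1}$ for $g\in G$. The Fourier transform is $F_G\colon A\to A^*$, $F_G(a)=w_G(a^*\cdot-)$; its image is $\tilde A$, and $F_G(a)_i$ is its component in ${\rm End}_k(E_i)$. On $\tilde A$, $tr(w)=\sum_i tr_i(w_i)$,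 where $tr_i(w_i)$ is the trace of the endomorphism $b\mapsto w_ib$ of the vector space ${\rm End}_k(E_i)$; one writes $\int_{\hat G}w=\int_{\hat G}w_i\,d\rho_i:=tr(w)$ for $w=(w_i)_i\in\tilde A$. The Fourier transform of $\hat G$ is $F_{\hat G}\colon\tilde A\to A$, $F_{\hat G}(w)(w')=tr(w^*\cdot w')$ for $w\in\tilde A$, $w'\in A^*$. *)

(* Defs.v *)
From HB Require Import structures.
From mathcomp Require Import all_boot all_order all_algebra.
From mathcomp Require Import all_classical.

Set Implicit Arguments.
Unset Strict Implicit.
Unset Printing Implicit Defensive.

Import GRing.Theory.
Local Open Scope classical_set_scope.
Local Open Scope quotient_scope.
Local Open Scope ring_scope.

(* Tensor product of two vector spaces: finite formal sums of pairs (u, v),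
   two sums being identified when no bilinear map separates them. *)
Section TensorProduct.
Context {k : fieldType} (U V : lmodType k).
Implicit Types s t : seq (U * V).

Definition is_bilinear (W : lmodType k) (b : U -> V -> W) : Prop :=
  (forall v, linear (b^~ v)) /\ (forall u, linear (b u)).

Definition teval (W : lmodType k) (b : U -> V -> W) s : W :=
  \sum_(p <- s) b p.1 p.2.

Definition teq s t : bool :=
  `[< forall (W : lmodType k) (b : U -> V -> W),
        is_bilinear b -> teval b s = teval b t >].

Lemma teq_refl : reflexive teq.
Proof. by move=> s; apply/asboolP. Qed.

Lemma teq_sym : symmetric teq.
Proof.
by move=> s t; apply/asboolP/asboolP => h W b hb; rewrite (h W b hb).
Qed.

Lemma teq_trans : transitive teq.
Proof.
move=> t s r /asboolP h1 /asboolP h2; apply/asboolP => W b hb.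
by rewrite (h1 W b hb) (h2 W b hb).
Qed.

Canonical teq_equiv := EquivRel teq teq_refl teq_sym teq_trans.

Definition tensor := {eq_quot teq_equiv}.
HB.instance Definition _ := Choice.on tensor.
HB.instance Definition _ := EqQuotient.on tensor.

Definition tpure (u : U) (v : V) : tensor := \pi_tensor [:: (u, v)].

(* The linear map out of the tensor product induced by b; only meaningful for
   bilinear b (tlift_pure, tlift_linear). *)
Definition tlift (W : lmodType k) (b : U -> V -> W) (x : tensor) : W :=
  teval b (repr x).

Lemma tlift_pi (W : lmodType k) (b : U -> V -> W) s :
  is_bilinear b -> tlift b (\pi_tensor s) = teval b s.
Proof.
move=> hb; rewrite /tlift; have /eqmodP/asboolP -> // : repr (\pi_tensor s) = s %[mod tensor].
by rewrite reprK.
Qed.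

Lemma tensor_eqP (x y : tensor) :
  (forall (W : lmodType k) (b : U -> V -> W), is_bilinear b -> tlift b x = tlift b y) ->
  x = y.
Proof.
move=> h; rewrite -[x]reprK -[y]reprK; apply/eqmodP/asboolP => W b hb.
exact: h.
Qed.

Definition tadd (x y : tensor) : tensor := \pi_tensor (repr x ++ repr y).
Definition tscale (c : k) (x : tensor) : tensor :=
  \pi_tensor [seq (c *: p.1, p.2) | p <- repr x].
Definition topp (x : tensor) : tensor := tscale (- 1) x.
Definition tzero : tensor := \pi_tensor [::].

Section Lift.
Variables (W : lmodType k) (b : U -> V -> W).
Hypothesis hb : is_bilinear b.

Lemma bilinZl c u v : b (c *: u) v = c *: b u v.
Proof.
have h0 : b 0 v = 0.
  by have := hb.1 v (-1) 0 0; rewrite scaler0 addr0 scaleN1r addNr.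
by have := hb.1 v c u 0; rewrite h0 !addr0.
Qed.

Lemma tlift_add x y : tlift b (tadd x y) = tlift b x + tlift b y.
Proof. by rewrite tlift_pi // /teval big_cat. Qed.

Lemma tlift_scale c x : tlift b (tscale c x) = c *: tlift b x.
Proof.
rewrite tlift_pi // /teval big_map scaler_sumr.
by apply: eq_bigr => p _; rewrite bilinZl.
Qed.

Lemma tlift_opp x : tlift b (topp x) = - tlift b x.
Proof. by rewrite tlift_scale scaleN1r. Qed.

Lemma tlift_zero : tlift b tzero = 0.
Proof. by rewrite tlift_pi // /teval big_nil. Qed.

Lemma tlift_pure u v : tlift b (tpure u v) = b u v.
Proof. by rewrite tlift_pi // /teval big_seq1. Qed.
End Lift.

Fact taddA : associative tadd.
Proof. by move=> x y z; apply: tensor_eqP => W b hb; rewrite !tlift_add // addrA. Qed.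

Fact taddC : commutative tadd.
Proof. by move=> x y; apply: tensor_eqP => W b hb; rewrite !tlift_add // addrC. Qed.

Fact tadd0 : left_id tzero tadd.
Proof. by move=> x; apply: tensor_eqP => W b hb; rewrite tlift_add // tlift_zero // add0r. Qed.

Fact taddN : left_inverse tzero topp tadd.
Proof.
by move=> x; apply: tensor_eqP => W b hb; rewrite tlift_add // tlift_opp // tlift_zero // addNr.
Qed.

HB.instance Definition _ := GRing.isZmodule.Build tensor taddA taddC tadd0 taddN.

Fact tscaleA c d x : tscale c (tscale d x) = tscale (c * d) x.
Proof. by apply: tensor_eqP => W b hb; rewrite !tlift_scale // scalerA. Qed.

Fact tscale1 : left_id 1 tscale.
Proof. by move=> x; apply: tensor_eqP => W b hb; rewrite tlift_scale // scale1r. Qed.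

Fact tscaleDr : right_distributive tscale +%R.
Proof.
move=> c x y; apply: tensor_eqP => W b hb.
by rewrite !(tlift_scale, tlift_add) // scalerDr.
Qed.

Fact tscaleDl x : {morph tscale^~ x : c d / c + d}.
Proof.
move=> c d; apply: tensor_eqP => W b hb.
by rewrite !(tlift_scale, tlift_add) // scalerDl.
Qed.

HB.instance Definition _ :=
  GRing.Zmodule_isLmodule.Build k tensor tscaleA tscale1 tscaleDr tscaleDl.

Lemma tlift_linear (W : lmodType k) (b : U -> V -> W) :
  is_bilinear b -> linear (tlift b).
Proof. by move=> hb c x y; rewrite tlift_add // tlift_scale. Qed.

Lemma tpure_bilinear : is_bilinear tpure.
Proof.
split=> [v c u u'|u c v v']; apply: tensor_eqP => W b hb.
  by rewrite tlift_add // tlift_scale // !tlift_pure // (hb.1 v).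
by rewrite tlift_add // tlift_scale // !tlift_pure // (hb.2 u).
Qed.

Lemma tensor_sum (x : tensor) : exists s : seq (U * V),
  x = \sum_(p <- s) tpure p.1 p.2.
Proof.
exists (repr x); apply: tensor_eqP => W b hb; rewrite {1}/tlift /teval.
elim: (repr x) => [|p s ih]; first by rewrite !big_nil tlift_zero.
by rewrite !big_cons ih tlift_add // tlift_pure.
Qed.

End TensorProduct.

Section TensorMaps.
Context {k : fieldType}.
Implicit Types U V W : lmodType k.

Definition tmap U V U' V' (f : U -> U') (g : V -> V') : tensor U V -> tensor U' V' :=
  tlift (fun u v => tpure (f u) (g v)).

Definition tassoc U V W : tensor (tensor U V) W -> tensor U (tensor V W) :=
  tlift (fun x w => tlift (fun u v => tpure u (tpure v w)) x).

Definition tmul (A : comAlgType k) (x y : tensor A A) : tensor A A :=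
  tlift (fun a a' => tlift (fun b b' => tpure (a * b) (a' * b')) y) x.

End TensorMaps.

(* The structure of an affine k-group on Spec A, that is, a structure of
   commutative Hopf algebra on A: comul, counit and antip are induced by the
   product, the unit and the inverse of G. *)
Record affine_group (k : fieldType) (A : comAlgType k) := AffineGroup {
  comul : {linear A -> tensor A A};
  counit : {lrmorphism A -> k^o};
  antip : {lrmorphism A -> A};
  comul1 : comul 1 = tpure 1 1;
  comulM : forall a b, comul (a * b) = tmul (comul a) (comul b);
  comulA : forall a, tassoc (tmap comul id (comul a)) = tmap id comul (comul a);
  counitl : forall a, tlift (fun x y => counit x *: y) (comul a) = a;
  counitr : forall a, tlift (fun x y => counit y *: x) (comul a) = a;
  antipl : forall a, tlift (fun x y => antip x * y) (comul a) = (counit a)%:A;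
  antipr : forall a, tlift (fun x y => x * antip y) (comul a) = (counit a)%:A
}.

Section Representations.
Context {k : fieldType} {A : comAlgType k} (G : affine_group A).

(* A linear representation of G on E, of arbitrary dimension: a right
   A-comodule. A point g : A -> B acts by e |-> (id (x) g) (coact e). *)
Record repr_of (E : lmodType k) := Repr {
  coact : {linear E -> tensor E A};
  coactA : forall e, tassoc (tmap coact id (coact e)) = tmap id (comul G) (coact e);
  coact_counit : forall e, tlift (fun x a => counit G a *: x) (coact e) = e
}.

Definition subspace (E : lmodType k) (F : set E) : Prop :=
  F 0 /\ forall (c : k) u v, F u -> F v -> F (c *: u + v).

(* F is a subspace and coact maps F into (the image of) F (x) A. *)
Definition subrep (E : lmodType k) (rho : repr_of E) (F : set E) : Prop :=
  subspace F /\
  forall e, F e -> exists s : seq (E * A),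
    (forall p, p \in s -> F p.1) /\ coact rho e = \sum_(p <- s) tpure p.1 p.2.

Definition irreducible (E : lmodType k) (rho : repr_of E) : Prop :=
  (exists e : E, e != 0) /\
  forall F : set E, subrep rho F -> F = [set 0] \/ F = setT.

Definition completely_reducible (E : lmodType k) (rho : repr_of E) : Prop :=
  forall F : set E, subrep rho F ->
    exists F' : set E, [/\ subrep rho F', F `&` F' = [set 0] &
      forall e, exists u v, [/\ F u, F' v & e = u + v]].

Definition linearly_semisimple : Prop :=
  forall (E : lmodType k) (rho : repr_of E), completely_reducible rho.

Definition isomorphic_repr (E E' : lmodType k) (rho : repr_of E) (rho' : repr_of E') : Prop :=
  exists f : {linear E -> E'}, bijective f /\
    forall e, coact rho' (f e) = tmap f id (coact rho e).

(* The matrix (a_rs) of functions on G with rho(e_s) = sum_r e_r (x) a_rs. *)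
Definition mxcoef (n : nat) (rho : repr_of 'cV[k]_n) : 'M[A]_n :=
  \matrix_(r, s) tlift (fun (e : 'cV[k]_n) (a : A) => e r 0 *: a)
                       (coact rho (delta_mx s 0)).

(* The set of irreducible representations of G up to isomorphism: one
   representative rho_i : G -> End(E_i), with E_i = k^(dim i), in every
   isomorphism class. *)
Record dual_set := DualSet {
  dual_index :> choiceType;
  dim : dual_index -> nat;
  irrep : forall i : dual_index, repr_of 'cV[k]_(dim i);
  irrep_irreducible : forall i, irreducible (irrep i);
  irrep_inj : forall i j, isomorphic_repr (irrep i) (irrep j) -> i = j;
  irrep_full : forall (E : lmodType k) (rho : repr_of E), irreducible rho ->
    exists i, isomorphic_repr rho (irrep i)
}.

End Representations.

(* {linear A -> B} is the extension of scalars of A^* to B; A^* itself is the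
   case B = k^o. *)
Section DualAlgebra.
Context {k : fieldType} {A : comAlgType k} (G : affine_group A) {B : comAlgType k}.

Definition conv (u v : {linear A -> B}) (a : A) : B :=
  tlift (fun x y => u x * v y) (comul G a).

Fact conv_is_linear u v : linear (conv u v).
Proof.
move=> c a b; rewrite /conv linearP tlift_linear //; split=> [y|x] d z t /=.
  by rewrite linearP mulrDl scalerAl.
by rewrite linearP mulrDr scalerAr.
Qed.

HB.instance Definition _ u v :=
  GRing.isLinear.Build k A B *:%R (conv u v) (conv_is_linear u v).

Definition dstar (u : {linear A -> B}) : {linear A -> B} := u \o antip G.

Definition dext (w : {linear A -> k^o}) (a : A) : B := (w a)%:A.

Fact dext_is_linear w : linear (dext w).
Proof. by move=> c a b; rewrite /dext linearP scalerDl scalerA. Qed.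

HB.instance Definition _ w :=
  GRing.isLinear.Build k A B *:%R (dext w) (dext_is_linear w).

(* The component of u in End(E_i) (x) B; for a point g this is rho_i(g). *)
Definition dcomp (Ghat : dual_set G) (u : {linear A -> B}) (i : Ghat) : 'M[B]_(dim i) :=
  map_mx u (mxcoef (irrep i)).

(* The integral over Ghat; lin_mulmx w is the endomorphism b |-> w b. The sum
   over the possibly infinite set Ghat is that of a finitely supported family
   (and 0 when the support is infinite). *)
Definition dual_int (Ghat : dual_set G) (w : forall i : Ghat, 'M[B]_(dim i)) : B :=
  \sum_(i \in [set: Ghat]) \tr (lin_mulmx (w i) : 'M[B]_(dim i * dim i)).

Definition dual_tr (Ghat : dual_set G) (u : {linear A -> B}) : B :=
  dual_int (@dcomp Ghat u).

End DualAlgebra.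

Section Fourier.
Context {k : fieldType} {A : comAlgType k} (G : affine_group A).

Definition invariant_integral (w : {linear A -> k^o}) : Prop :=
  w 1 = 1 /\
  forall (B : comAlgType k) (g : {lrmorphism A -> B}), conv G g (dext w) =1 dext w.

(* The subspace of A^* of the w with finitely many nonzero components. *)
Definition in_Atilde (Ghat : dual_set G) (w : {linear A -> k^o}) : Prop :=
  finite_set [set i : Ghat | dcomp w i != 0].

Definition fourier (wG : {linear A -> k^o}) (a : A) (b : A) : k^o :=
  wG (antip G a * b).

Fact fourier_is_linear wG a : linear (fourier wG a).
Proof. by move=> c x y; rewrite /fourier mulrDr -scalerAr linearP. Qed.

HB.instance Definition _ wG a :=
  GRing.isLinear.Build k A k^o *:%R (fourier wG a) (fourier_is_linear wG a).

(* The element b of A with w'(b) = tr(w^* w') for all w' in A^*; it is unique,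
   since A^* separates the elements of A. *)
Definition dual_fourier (Ghat : dual_set G) (w : {linear A -> k^o}) : A :=
  xget 0 [set b : A | forall w' : {linear A -> k^o},
                        w' b = dual_tr Ghat (conv G (dstar G w) w')].

End Fourier.

(* Main.v *)
Require Import Defs.
From HB Require Import structures.
From mathcomp Require Import all_boot all_order all_algebra.
From mathcomp Require Import finmap.
From mathcomp Require Import all_classical.
Import GRing.Theory.
Local Open Scope ring_scope.
Set Implicit Arguments.
Unset Strict Implicit.
Unset Printing Implicit Defensive.

(** Write w for the invariant integral, S for the antipode, and M_i for the matrix of
    functions on G attached to the irreducible representation E_i, of dimension d_i.
    The heart of the matter is the inversion formula [fourier_inversion]: for every
    linear map u : A -> B,

        sum over i of d_i tr (F(a)_i u(M_i)) = u(a),  where F(a)_i = w (S(a) M_i),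

    and the sum is finite. Both sides are linear in a, so two facts prove it.

    - Peter-Weyl ([peter_weyl]): the entries of the M_i span A. Their span is a
      subrepresentation of the regular representation, hence has a complement C.
      A nonzero C would contain a finite-dimensional irreducible representation
      ([irreducible_sub]); but the elements of a subrepresentation of A are
      combinations of its own matrix coefficients, so it would meet the span.

    - Schur orthogonality ([orthogonality_neq], [orthogonality_eq]): the average
      w (M_i E S(M_j)), for a matrix E over k, intertwines E_j and E_i, so it vanishes if
      i <> j and is a scalar matrix if i = j, k being algebraically closed; comparing
      traces gives the scalar, and shows that d_i is invertible in k. Therefore, when
      a is the (t, q) entry of M_j, F(a)_i = 0 for i <> j and F(a)_j is 1 / d_j times
      the elementary matrix in position (q, t), for which the formula is evident.

    The four equalities follow. S is an involution and w is invariant under S, so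
    that F(a)^* = F(S(a)) ([dstar_fourier]). The inversion formula at S(a) then says that
    the inverse transform of F(a) is S(a) ([dual_fourier_fourier]) and computes the
    integral of F(a)^* g^*; at a, with u = g, it computes the last integral. *)

(* Other imported files define the same two names. *)
Local Notation repr_of := Defs.repr_of.
Local Notation dim := Defs.dim.

(** * Functionals and free families in arbitrary vector spaces *)

Section LinearAlgebra.
Context {k : fieldType}.
Implicit Types U V W : lmodType k.

(** Turns the property of being linear into an object of the linear map type, to which
    the generic lemmas on sums apply. *)
Lemma linear_bundle U V (f : U -> V) : linear f -> {g : {linear U -> V} | g =1 f}.
Proof.
move=> lf; pose g : {linear U -> V} := HB.pack f (GRing.isLinear.Build k U V *:%R f lf).
by exists g.
Qed.

Lemma subspace_sum V (F : set V) : subspace F ->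
  forall (I : Type) (r : seq I) (c : I -> k) (x : I -> V),
    (forall i, F (x i)) -> F (\sum_(i <- r) c i *: x i).
Proof.
move=> [F0 FL] I r c x Fx; elim: r => [|i r ih]; first by rewrite big_nil.
by rewrite big_cons; apply: FL.
Qed.

Definition lin_free V n (x : 'I_n -> V) : Prop :=
  forall c : 'I_n -> k, \sum_i c i *: x i = 0 -> forall i, c i = 0.

(** Zorn gives a subspace H that contains M, avoids v and is maximal for this. By
    maximality every vector is congruent modulo H to a unique multiple of v; its
    coefficient is the functional. *)
Lemma functional_sep V (M : set V) (v : V) : subspace M -> ~ M v ->
  exists f : {linear V -> k^o}, (forall u, M u -> f u = 0) /\ f v = 1.
Proof.
move=> [M0 ML] nMv.
(* The union with M keeps the empty chain admissible. *)
pose P (N : set V) := (subspace (N `|` M) /\ ~ N v)%classic.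
have [|N [[[_ NL] nNv] maxN]] := @Zorn_bigcup V P.
  move=> F FP totF; split; last by move=> [X FX Xv]; case: (FP X FX).
  split=> [|c x y]; first by right.
  move=> [[X FX Xx]|Mx] [[Y FY Yy]|My].
  - have [XY|YX] := totF X Y FX FY.
      have [[_ /(_ c x y) L] _] := FP Y FY.
      case: L => [||h|h]; [by left; apply: XY|by left|by left; exists Y|by right].
    have [[_ /(_ c x y) L] _] := FP X FX.
    by case: L => [||h|h]; [left|left; apply: YX|left; exists X|right].
  - have [[_ /(_ c x y) L] _] := FP X FX.
    by case: L => [||h|h]; [left|right|left; exists X|right].
  - have [[_ /(_ c x y) L] _] := FP Y FY.
    by case: L => [||h|h]; [right|left|left; exists Y|right].
  - by right; apply: ML.
pose H := (N `|` M)%classic.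
have H0 : H 0 by right.
have HL c x y : H x -> H y -> H (c *: x + y) by exact: NL.
have nHv : ~ H v by move=> [].
have HB x y : H x -> H y -> H (x - y).
  by move=> hx hy; rewrite addrC -scaleN1r; apply: HL.
have HZ c x : H x -> H (c *: x) by move=> hx; rewrite -[_ *: _]addr0; apply: HL.
have ex u : exists c : k, H (u - c *: v).
  have [Hu|nHu] := EM (H u); first by exists 0; rewrite scale0r subr0.
  pose N' := [set x | exists c, H (x - c *: u)]%classic.
  have HN' : (H `<=` N')%classic by move=> x Hx; exists 0; rewrite scale0r subr0.
  have [[c hc]|nN'v] := EM (N' v).
    have c0 : c != 0.
      by apply/eqP => c0; apply: nHv; move: hc; rewrite c0 scale0r subr0.
    exists c^-1; rewrite (_ : _ - _ = (- c^-1) *: (v - c *: u)); first exact: HZ.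
    by rewrite scalerBr scalerA mulNr mulVf // scaleN1r opprK addrC scaleNr.
  case: (maxN N').
    split; first by move=> x Nx; apply: HN'; left.
    by move/(_ u) => h; apply: nHu; left; apply: h; exists 1; rewrite scale1r subrr.
  split=> //; split=> [|c x y]; first by right.
  move=> hx hy; left.
  have [a ha] : N' x by case: hx => // Mx; apply: HN'; right.
  have [b hb] : N' y by case: hy => // My; apply: HN'; right.
  exists (c * a + b); rewrite (_ : _ - _ = c *: (x - a *: u) + (y - b *: u)); first exact: HL.
  by rewrite scalerBr scalerDl opprD scalerA addrACA.
have uq u c d : H (u - c *: v) -> H (u - d *: v) -> c = d.
  move=> hc hd; have := HB _ _ hc hd; rewrite opprB addrC addrA subrK -scalerBl.
  have [/eqP|ne] := eqVneq (d - c) 0; first by rewrite subr_eq0 => /eqP.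
  by move=> /(HZ (d - c)^-1); rewrite scalerA mulVf // scale1r.
pose f u : k^o := projT1 (cid (ex u)).
have fP u : H (u - f u *: v) by rewrite /f; case: (cid _).
have lf : linear f.
  move=> c x y; apply: (uq (c *: x + y)) => //.
  rewrite (_ : _ - _ = c *: (x - f x *: v) + (y - f y *: v)); first exact: HL.
  by rewrite scalerBr scalerDl opprD scalerA addrACA.
have [g gf] := linear_bundle lf; exists g; split=> [u Mu|]; rewrite gf.
  by apply: (uq u) => //; rewrite scale0r subr0; right.
by apply: (uq v) => //; rewrite scale1r subrr.
Qed.

(** Coordinates on the span of a free family extend to the whole space. *)
Lemma free_coord V n (x : 'I_n -> V) : lin_free x ->
  exists f : 'I_n -> {linear V -> k^o}, forall i j, f i (x j) = (i == j)%:R.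
Proof.
move=> fx; suff /choice [f hf] : forall i, exists f : {linear V -> k^o}, forall j, f (x j) = (i == j)%:R.
  by exists f.
move=> i; pose M := [set u | exists2 c : 'I_n -> k, c i = 0 & u = \sum_j c j *: x j]%classic.
have [||f [fM fi]] := @functional_sep V M (x i).
- split=> [|c u v [a ai ->] [b bi ->]].
    by exists (fun=> 0) => //; rewrite big1 // => j _; rewrite scale0r.
  exists (fun j => c * a j + b j); first by rewrite ai bi mulr0 addr0.
  by rewrite scaler_sumr -big_split; apply: eq_bigr => j _ /=; rewrite scalerDl scalerA.
- move=> [c ci e]; have /(_ _ i)/eqP := fx (fun j => c j - (i == j)%:R).
  rewrite ci eqxx sub0r oppr_eq0 oner_eq0 => h; apply/notF/h => {h}.
  under eq_bigr do rewrite scalerBl; rewrite big_split /= -e.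
  rewrite (bigD1 i) //= eqxx scale1r big1 ?addr0 ?subrr // => j ne.
  by rewrite eq_sym (negbTE ne) scale0r oppr0.
exists f => j; have [<-|ne] := eqVneq i j; first by rewrite fi.
apply: fM; exists (fun l => (l == j)%:R); first by rewrite (negbTE ne).
rewrite (bigD1 j) //= eqxx scale1r big1 ?addr0 // => l /negbTE ->.
by rewrite scale0r.
Qed.

Definition lincomb V n (x : 'I_n -> V) (e : 'cV[k]_n) : V := \sum_i e i 0 *: x i.

Fact lincomb_is_linear V n (x : 'I_n -> V) : linear (lincomb x).
Proof.
move=> c u v; rewrite /lincomb scaler_sumr -big_split.
by apply: eq_bigr => i _ /=; rewrite !mxE scalerDl scalerA.
Qed.

HB.instance Definition _ V n (x : 'I_n -> V) :=
  GRing.isLinear.Build k 'cV[k]_n V *:%R (lincomb x) (lincomb_is_linear x).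

Lemma lincomb_delta V n (x : 'I_n -> V) i : lincomb x (delta_mx i 0) = x i.
Proof.
rewrite /lincomb (bigD1 i) //= mxE !eqxx scale1r big1 ?addr0 // => j /negbTE ne.
by rewrite mxE ne scale0r.
Qed.

Lemma lincomb_retract V n (x : 'I_n -> V) : lin_free x ->
  exists p : {linear V -> 'cV[k]_n}, cancel (lincomb x) p.
Proof.
move=> /free_coord [f hf].
have lp : linear (fun u => \col_i (f i u : k)).
  by move=> c u v; apply/colP => i; rewrite !mxE linearP.
have [p pE] := linear_bundle lp; exists p => e; rewrite pE; apply/colP => i.
rewrite mxE linear_sum (bigD1 i) //= linearZ /= hf eqxx big1 ?addr0 ?[_ *: _]mulr1 // => j ne.
by rewrite linearZ /= hf eq_sym (negbTE ne) scaler0.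
Qed.

Lemma cV_sum n (e : 'cV[k]_n) : e = \sum_i e i 0 *: delta_mx i 0.
Proof.
apply/colP => i; rewrite summxE (bigD1 i) //= !mxE !eqxx mulr1 big1 ?addr0 //.
by move=> j ne; rewrite !mxE eq_sym (negbTE ne) mulr0.
Qed.

Lemma linear_cV_ext V n (f g : {linear 'cV[k]_n -> V}) :
  (forall i, f (delta_mx i 0) = g (delta_mx i 0)) -> f =1 g.
Proof.
move=> h e; rewrite (cV_sum e) !linear_sum; apply: eq_bigr => i _.
by rewrite !linearZ /= h.
Qed.

End LinearAlgebra.

(** * Calculus in tensor products *)

Section TensorTools.
Context {k : fieldType}.
Implicit Types U V W : lmodType k.

Lemma bilinear_comp U V W U' V' (b : U' -> V' -> W) (f : U -> U') (g : V -> V') :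
  is_bilinear b -> linear f -> linear g -> is_bilinear (fun u v => b (f u) (g v)).
Proof.
by move=> [b1 b2] lf lg; split=> [v|u] c x y /=; [rewrite lf b1|rewrite lg b2].
Qed.

Lemma bilinear_post U V W W' (b : U -> V -> W) (f : W -> W') :
  is_bilinear b -> linear f -> is_bilinear (fun u v => f (b u v)).
Proof. by move=> [b1 b2] lf; split=> [v|u] c x y /=; [rewrite b1 lf|rewrite b2 lf]. Qed.

Lemma bilinear_mul (A : comAlgType k) : is_bilinear (fun x y : A => x * y).
Proof. by split=> [v|u] c x y /=; rewrite ?mulrDl -?scalerAl ?mulrDr -?scalerAr. Qed.

Lemma bilinear_scale U : is_bilinear (fun (c : k^o) (u : U) => (c : k) *: u).
Proof.
split=> [v|u] c x y /=; first by rewrite scalerDl -scalerA.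
by rewrite scalerDr !scalerA mulrC.
Qed.

Lemma bilinear_scale_r U : is_bilinear (fun (u : U) (c : k^o) => (c : k) *: u).
Proof. by have [b1 b2] := bilinear_scale U; split. Qed.

Lemma linear_id U : linear (fun u : U => u).
Proof. by []. Qed.

Lemma bilinear_functional_l U V (f : U -> k^o) : linear f ->
  is_bilinear (fun (u : U) (v : V) => (f u : k) *: v).
Proof. by move=> lf; exact: (bilinear_comp (bilinear_scale V) lf (@linear_id V)). Qed.

Lemma bilinear_functional_r U V (f : V -> k^o) : linear f ->
  is_bilinear (fun (u : U) (v : V) => (f v : k) *: u).
Proof. by move=> lf; exact: (bilinear_comp (bilinear_scale_r U) (@linear_id U) lf). Qed.

Lemma linear_comp U V W (f : V -> W) (g : U -> V) :
  linear f -> linear g -> linear (fun u => f (g u)).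
Proof. by move=> lf lg c x y; rewrite lg lf. Qed.

Lemma tmap_bilinear U V U' V' (f : U -> U') (g : V -> V') :
  linear f -> linear g -> is_bilinear (fun u v => tpure (f u) (g v)).
Proof. by move=> lf lg; apply: bilinear_comp => //; apply: tpure_bilinear. Qed.

Lemma tmap_linear U V U' V' (f : U -> U') (g : V -> V') :
  linear f -> linear g -> linear (tmap f g).
Proof. by move=> lf lg; apply/tlift_linear/tmap_bilinear. Qed.

Lemma tmap_pure U V U' V' (f : U -> U') (g : V -> V') u v :
  linear f -> linear g -> tmap f g (tpure u v) = tpure (f u) (g v).
Proof. by move=> lf lg; rewrite /tmap tlift_pure //; apply: tmap_bilinear. Qed.

Lemma tassoc_bilinear1 U V W (w : W) :
  is_bilinear (fun (u : U) (v : V) => tpure u (tpure v w)).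
Proof.
have [t1 t2] := @tpure_bilinear k U (tensor V W).
have [t3 _] := @tpure_bilinear k V W.
by split=> [v|u]; [exact: t1|exact: (linear_comp (t2 u) (t3 w))].
Qed.

Lemma tensor_ext U V W (f g : tensor U V -> W) : linear f -> linear g ->
  (forall u v, f (tpure u v) = g (tpure u v)) -> f =1 g.
Proof.
move=> lf lg h x; have [s ->] := tensor_sum x.
have [f' f'E] := linear_bundle lf; have [g' g'E] := linear_bundle lg.
by rewrite -f'E -g'E !linear_sum; apply: eq_bigr => p _; rewrite f'E g'E.
Qed.

Lemma tassoc_bilinear U V W :
  is_bilinear (fun (x : tensor U V) (w : W) => tlift (fun u v => tpure u (tpure v w)) x).
Proof.
pose L (w : W) := tlift (fun (u : U) (v : V) => tpure u (tpure v w)).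
have lL w : linear (L w) by apply/tlift_linear/tassoc_bilinear1.
have Lp w u v : L w (tpure u v) = tpure u (tpure v w).
  by rewrite /L tlift_pure //; apply: tassoc_bilinear1.
split=> [w|x]; first exact: lL.
move=> c w w'; rewrite -/(L _) -/(L w) -/(L w').
suff /(_ x) : L (c *: w + w') =1 (fun x => c *: L w x + L w' x) by [].
apply: tensor_ext => [|d y z|u v]; first exact: lL.
  by rewrite !lL !scalerDr !scalerA mulrC addrACA.
have [_ t2] := @tpure_bilinear k U (tensor V W).
have [_ t3] := @tpure_bilinear k V W.
by rewrite !Lp t3 t2.
Qed.

Lemma tassoc_linear U V W : linear (@tassoc k U V W).
Proof. exact/tlift_linear/tassoc_bilinear. Qed.

Lemma tassoc_pure U V W (u : U) (v : V) (w : W) :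
  tassoc (tpure (tpure u v) w) = tpure u (tpure v w).
Proof.
by rewrite /tassoc !tlift_pure //; [exact: tassoc_bilinear1|exact: tassoc_bilinear].
Qed.

Lemma linear_sumE U V (f : U -> V) : linear f ->
  forall (I : Type) (r : seq I) (P : pred I) (x : I -> U),
    f (\sum_(i <- r | P i) x i) = \sum_(i <- r | P i) f (x i).
Proof.
move=> lf I r P x; have [g gE] := linear_bundle lf.
by rewrite -gE linear_sum; apply: eq_bigr => i _; rewrite gE.
Qed.

Lemma linear_scaleE U V (f : U -> V) : linear f -> forall c u, f (c *: u) = c *: f u.
Proof. by move=> lf c u; have [g gE] := linear_bundle lf; rewrite -!gE linearZ. Qed.

Lemma linear_0E U V (f : U -> V) : linear f -> f 0 = 0.
Proof. by move=> lf; have [g gE] := linear_bundle lf; rewrite -gE linear0. Qed.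

(** If x_j is a combination of the other x_i, its term can be distributed over the
    others by changing the second factors. *)
Lemma bilinear_drop U V W (b : U -> V -> W) n (x : 'I_n.+1 -> U) (y : 'I_n.+1 -> V)
    (c : 'I_n.+1 -> k) j : is_bilinear b -> c j != 0 -> \sum_i c i *: x i = 0 ->
  \sum_i b (x i) (y i) =
  \sum_i b (x (lift j i)) (y (lift j i) - (c (lift j i) / c j) *: y j).
Proof.
move=> [b1 b2] cj c0.
have -> : \sum_i b (x i) (y i) = \sum_i b (x i) (y i - (c i / c j) *: y j).
  transitivity (\sum_i b (x i) (y i) - (c j)^-1 *: b (\sum_i c i *: x i) (y j)).
    by rewrite c0 (linear_0E (b1 (y j))) scaler0 subr0.
  rewrite (linear_sumE (b1 (y j))) scaler_sumr -sumrB; apply: eq_bigr => i _.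
  rewrite (linear_scaleE (b1 (y j))) scalerA mulrC.
  by rewrite [in RHS]addrC -[in RHS]scaleNr b2 scaleNr addrC.
rewrite (bigD1_ord j) //= mulfV // scale1r subrr.
by rewrite (linear_0E (b2 _)) add0r.
Qed.

(** As long as there is a linear relation on one side, one term is absorbed by the
    others; the first factors stay in the subspace F. *)
Lemma tensor_free U V (F : set U) (s : seq (U * V)) :
  subspace F -> (forall p, p \in s -> F p.1) ->
  exists n (x : 'I_n -> U) (y : 'I_n -> V),
    [/\ lin_free x, lin_free y, forall i, F (x i) &
        \sum_(p <- s) tpure p.1 p.2 = \sum_i tpure (x i) (y i)].
Proof.
move=> sF Fs.
have [n [x [y [Fx ->]]]] : exists n (x : 'I_n -> U) (y : 'I_n -> V),
    (forall i, F (x i)) /\ \sum_(p <- s) tpure p.1 p.2 = \sum_i tpure (x i) (y i).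
  exists (size s), (fun i => (tnth (in_tuple s) i).1), (fun i => (tnth (in_tuple s) i).2).
  split=> [i|]; first by apply/Fs/mem_tnth.
  by rewrite big_tnth.
have bt := @tpure_bilinear k U V.
have bt' : is_bilinear (fun v u => @tpure k U V u v) by case: bt.
elim: n x y Fx => [|n ih] x y Fx; first by exists 0, x, y; split=> // c _ [].
have [fx|] := EM (lin_free x); last first.
  move=> /existsNP [c /not_implyP [c0 /existsNP [j /eqP cj]]].
  by rewrite (bilinear_drop y bt cj c0); apply: ih.
have [fy|] := EM (lin_free y); last first.
  move=> /existsNP [c /not_implyP [c0 /existsNP [j /eqP cj]]].
  rewrite (bilinear_drop x bt' cj c0); apply: ih => i.
  by rewrite addrC -scaleNr; apply: sF.2.
by exists n.+1, x, y.
Qed.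

Lemma tmap_tmap U V U' V' U'' V'' (f : U' -> U'') (g : V' -> V'') (f' : U -> U') (g' : V -> V') :
  linear f -> linear g -> linear f' -> linear g' ->
  forall t, tmap f g (tmap f' g' t) = tmap (fun u => f (f' u)) (fun v => g (g' v)) t.
Proof.
move=> lf lg lf' lg'; apply: tensor_ext => [||u v].
- by apply: linear_comp; apply: tmap_linear.
- by apply: tmap_linear; apply: linear_comp.
- by rewrite !tmap_pure //; apply: linear_comp.
Qed.

Lemma tmap_id U V (t : tensor U V) : tmap (fun u => u) (fun v => v) t = t.
Proof.
move: t; apply: tensor_ext => //; first exact: tmap_linear.
by move=> u v; rewrite tmap_pure.
Qed.

Lemma tassoc_tmap U V W U' V' W' (f : U -> U') (g : V -> V') (h : W -> W') :
  linear f -> linear g -> linear h ->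
  forall t, tassoc (tmap (tmap f g) h t) = tmap f (tmap g h) (tassoc t).
Proof.
move=> lf lg lh; have lfg := tmap_linear lf lg; have lgh := tmap_linear lg lh.
apply: tensor_ext => [||t w].
- by apply: linear_comp; [exact: tassoc_linear|exact: tmap_linear].
- by apply: linear_comp; [exact: tmap_linear|exact: tassoc_linear].
rewrite tmap_pure //; move: t; apply: tensor_ext => [||u v].
- apply: (linear_comp (f := @tassoc k U' V' W')); first exact: tassoc_linear.
  apply: (linear_comp (f := fun x => tpure x (h w))) => //.
  by have [t1 _] := @tpure_bilinear k (tensor U' V') W'; exact: t1.
- apply: (linear_comp (f := tmap f (tmap g h))); first exact: tmap_linear.
  apply: (linear_comp (f := @tassoc k U V W)); first exact: tassoc_linear.
  by have [t1 _] := @tpure_bilinear k (tensor U V) W; exact: t1.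
- by rewrite !(tmap_pure, tassoc_pure).
Qed.

Lemma tlift_tmap U V U' V' W (b : U' -> V' -> W) (f : U -> U') (g : V -> V') :
  is_bilinear b -> linear f -> linear g ->
  forall t, tlift b (tmap f g t) = tlift (fun u v => b (f u) (g v)) t.
Proof.
move=> hb lf lg; have hb' := bilinear_comp hb lf lg; apply: tensor_ext => [||u v].
- by apply: linear_comp; [exact: tlift_linear|exact: tmap_linear].
- exact: tlift_linear.
- by rewrite tmap_pure // !tlift_pure.
Qed.

Lemma linear_tlift U V W W' (b : U -> V -> W) (f : W -> W') : is_bilinear b -> linear f ->
  forall t, f (tlift b t) = tlift (fun u v => f (b u v)) t.
Proof.
move=> hb lf; have hb' := bilinear_post hb lf; apply: tensor_ext => [||u v].
- by apply: linear_comp => //; apply: tlift_linear.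
- exact: tlift_linear.
- by rewrite !tlift_pure.
Qed.

Lemma tlift_sum U V W (b : U -> V -> W) : is_bilinear b ->
  forall (I : Type) (r : seq I) (x : I -> U) (y : I -> V),
  tlift b (\sum_(i <- r) tpure (x i) (y i)) = \sum_(i <- r) b (x i) (y i).
Proof.
move=> hb I r x y; rewrite (linear_sumE (tlift_linear hb)).
by apply: eq_bigr => i _; rewrite tlift_pure.
Qed.

Lemma tmap_sum U V U' V' (f : U -> U') (g : V -> V') : linear f -> linear g ->
  forall (I : Type) (r : seq I) (x : I -> U) (y : I -> V),
  tmap f g (\sum_(i <- r) tpure (x i) (y i)) = \sum_(i <- r) tpure (f (x i)) (g (y i)).
Proof. by move=> lf lg I r x y; apply: tlift_sum; apply: tmap_bilinear. Qed.

End TensorTools.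

(** * Subrepresentations, Schur's lemma and local finiteness *)

Section Representations.
Context {k : fieldType} {A : comAlgType k} (G : affine_group A).
Implicit Types E : lmodType k.

Definition equivariant E E' (rho : repr_of G E) (rho' : repr_of G E') (f : E -> E') : Prop :=
  forall e, coact rho' (f e) = tmap f id (coact rho e).

Lemma counit_bilinear E : is_bilinear (fun (x : E) (a : A) => counit G a *: x).
Proof. exact/bilinear_functional_r/linearP. Qed.

Lemma subrep_free E (rho : repr_of G E) (F : set E) e : subrep rho F -> F e ->
  exists n (x : 'I_n -> E) (y : 'I_n -> A),
    [/\ lin_free x, lin_free y, forall i, F (x i) &
        coact rho e = \sum_i tpure (x i) (y i)].
Proof.
by move=> [sF hF] /hF [s [Fs ->]]; apply: tensor_free.
Qed.

Lemma subrepT E (rho : repr_of G E) : subrep rho setT.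
Proof. by split=> // e _; have [s ->] := tensor_sum (coact rho e); exists s. Qed.

Lemma image_subrep E E' (rho : repr_of G E) (rho' : repr_of G E') (f : {linear E -> E'})
  (F : set E) : equivariant rho rho' f -> subrep rho F -> subrep rho' (f @` F)%classic.
Proof.
move=> ef [[F0 FL] hF]; split.
  split=> [|c _ _ [u Fu <-] [v Fv <-]]; first by exists 0; rewrite ?linear0.
  by exists (c *: u + v); rewrite ?linearP //; apply: FL.
move=> _ [e Fe <-]; have [s [Fs es]] := hF e Fe.
exists [seq (f p.1, p.2) | p <- s]; split.
  by move=> _ /mapP [p ps ->]; exists p.1 => //; apply: Fs.
by rewrite ef es tmap_sum ?big_map //; apply: linearP.
Qed.

(** If the coaction of e is a sum of x_i (x) y_i with the y_i free, then f (e) = 0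
    forces all f (x_i) = 0. *)
Lemma ker_subrep E E' (rho : repr_of G E) (rho' : repr_of G E') (f : {linear E -> E'}) :
  equivariant rho rho' f -> subrep rho [set e | f e = 0]%classic.
Proof.
move=> ef; split.
  split=> [|c u v /= fu fv]; first exact: linear0.
  by rewrite linearP fu fv scaler0 addr0.
move=> e fe; have [n [x [y [_ fy _ xy]]]] := subrep_free (subrepT rho) (I : setT e).
exists [seq (x i, y i) | i <- enum 'I_n]; split; last first.
  by rewrite big_map big_enum.
move=> _ /mapP [j _ ->] /=; have [d dE] := free_coord fy.
have bb : is_bilinear (fun (u : E') (a : A) => d j a *: u).
  exact/bilinear_functional_r/linearP.
have := ef e; rewrite fe linear0 xy tmap_sum; [|exact: linearP|by []].
move=> /(congr1 (tlift (fun (u : E') (a : A) => d j a *: u))).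
rewrite tlift_sum // (linear_0E (tlift_linear bb)) (bigD1 j) //= dE eqxx scale1r.
rewrite big1 ?addr0 // => i ne.
by rewrite dE eq_sym (negbTE ne) scale0r.
Qed.

Lemma irreducible_dim_gt0 n (rho : repr_of G 'cV[k]_n) : irreducible rho -> (0 < n)%N.
Proof.
move=> [[e ne] _]; rewrite lt0n; apply: contraNneq ne => n0; apply/eqP/colP => j.
by have := ltn_ord j; rewrite [X in (_ < X)%N]n0.
Qed.

(** The kernel and the image of f are subrepresentations. *)
Lemma schur E E' (rho : repr_of G E) (rho' : repr_of G E') (f : {linear E -> E'}) :
  irreducible rho -> irreducible rho' -> equivariant rho rho' f ->
  (forall e, f e = 0) \/ bijective f.
Proof.
move=> [_ irr] [_ irr'] ef.
have [k0|kT] := irr _ (ker_subrep ef); last first.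
  by left=> e; have : [set e | f e = 0]%classic e by rewrite kT.
have [i0|iT] := irr' _ (image_subrep ef (subrepT rho)).
  left=> e; have : (f @` setT)%classic (f e) by exists e.
  by rewrite i0.
right; have /choice [g gK] : forall e', exists e, f e = e'.
  by move=> e'; have : (f @` setT)%classic e' by [rewrite iT]; case=> e _; exists e.
have finj : injective f.
  move=> u v fuv; apply/eqP; rewrite -subr_eq0; apply/eqP.
  have : [set e | f e = 0]%classic (u - v) by rewrite /= linearB fuv subrr.
  by rewrite k0.
by exists g => // e; apply: finj; rewrite gK.
Qed.

(** Coassociativity, read against the coordinates dual to the free y_i, makes the
    span of the x_i stable. *)
Lemma local_finiteness E (rho : repr_of G E) (F : set E) e : subrep rho F -> F e -> e != 0 ->
  exists n (x : 'I_n -> E), [/\ (0 < n)%N, lin_free x, forall i, F (x i) &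
    forall j, exists t : tensor 'cV[k]_n A, coact rho (x j) = tmap (lincomb x) id t].
Proof.
move=> sF Fe ne; have [n [x [y [fx fy Fx xy]]]] := subrep_free sF Fe.
exists n, x; split=> //.
  case: n => [|//] in x y fx fy Fx xy *; case/eqP: ne.
  rewrite -(coact_counit rho e) xy big_ord0.
  by rewrite (linear_0E (tlift_linear (counit_bilinear E))).
move=> j; have [d dE] := free_coord fy; have lD := linearP (comul G).
pose b (a b : A) : A := (d j b : k) *: a.
have bb : is_bilinear b by exact/bilinear_functional_r/linearP.
pose g := tlift b; have lg : linear g by apply: tlift_linear.
have gE t a : tmap id g (tassoc (tpure t a)) = d j a *: t :> tensor E A.
  move: t; apply: tensor_ext => [||u v].
  - apply: (linear_comp (f := tmap id g)); first exact: tmap_linear.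
    apply: (linear_comp (f := @tassoc k E A A)); first exact: tassoc_linear.
    by have [t1 _] := @tpure_bilinear k (tensor E A) A; exact: t1.
  - by move=> c u v; rewrite scalerDr !scalerA mulrC.
  rewrite tassoc_pure tmap_pure // /g tlift_pure //.
  by have [_ t2] := @tpure_bilinear k E A; rewrite (linear_scaleE (t2 _)).
exists (\sum_i tpure (delta_mx i 0) (g (comul G (y i)))).
rewrite tmap_sum; [|exact: linearP|by []].
under eq_bigr do rewrite lincomb_delta.
have := congr1 (tmap id g) (coactA rho e).
rewrite xy tmap_sum; [|exact: linearP|by []].
rewrite tmap_sum // tmap_sum //.
move=> <-; rewrite (linear_sumE (@tassoc_linear k E A A)).
rewrite (linear_sumE (tmap_linear (@linear_id k E) lg)).
rewrite (bigD1 j) //= gE dE eqxx scale1r big1 ?addr0 // => i ni.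
by rewrite gE dE eq_sym (negbTE ni) scale0r.
Qed.

(** The coaction of E' is that of E between f and p; stability of the image of f says
    that f (x) id turns it back into the coaction of E, whence coassociativity. *)
Lemma sub_repr E E' (rho : repr_of G E) (f : {linear E' -> E}) (p : {linear E -> E'}) :
  cancel f p ->
  (forall v, coact rho (f v) = tmap f id (tmap p id (coact rho (f v)))) ->
  exists rho' : repr_of G E', equivariant rho' rho f.
Proof.
move=> fK hf; have lD := linearP (comul G).
have lp : linear p := linearP p; have lf : linear f := linearP f.
have lc : linear (coact rho) := linearP (coact rho).
have ltp : linear (@tmap k E A E' A p id) by apply: tmap_linear.
have lc' : linear (fun v => tmap p id (coact rho (f v))).
  by apply: (linear_comp ltp); apply: linear_comp.
have [c cE] := linear_bundle lc'.
have cA e : tassoc (tmap c id (c e)) = tmap id (comul G) (c e).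
  rewrite (_ : (c : E' -> _) = (fun v => tmap p id (coact rho (f v)))); last exact/funext.
  have e1 t : tmap (fun v => tmap p id (coact rho (f v))) id t =
      tmap (tmap p id) id (tmap (coact rho) id (tmap f id t)) :> tensor (tensor E' A) A.
    by rewrite !tmap_tmap //; exact: linear_comp.
  rewrite e1 -hf tassoc_tmap // coactA !tmap_tmap //; last exact: tmap_linear.
  by congr tmap; apply/funext => a; rewrite tmap_id.
have cC e : tlift (fun x a => counit G a *: x) (c e) = e.
  rewrite cE tlift_tmap //; last exact: counit_bilinear.
  rewrite -[RHS]fK -{2}(coact_counit rho (f e)) linear_tlift //; last exact: counit_bilinear.
  by congr tlift; apply/funext => x; apply/funext => a; rewrite linearZ.
by exists (Repr cA cC) => v /=; rewrite cE -hf.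
Qed.

Lemma lincomb_repr E (rho : repr_of G E) n (x : 'I_n -> E) : lin_free x ->
  (forall j, exists t : tensor 'cV[k]_n A, coact rho (x j) = tmap (lincomb x) id t) ->
  exists rho' : repr_of G 'cV[k]_n, equivariant rho' rho (lincomb x).
Proof.
move=> /lincomb_retract [p pK] hx; apply: (sub_repr pK).
have lp := linearP p; have lx := linearP (lincomb x).
have lc : linear (coact rho) := linearP (coact rho).
have [f1 f1E] := linear_bundle (linear_comp lc lx).
have [f2 f2E] := linear_bundle (linear_comp (tmap_linear lx (@linear_id k A))
  (linear_comp (tmap_linear lp (@linear_id k A)) (linear_comp lc lx))).
move=> v; rewrite -[LHS]f1E -[RHS]f2E; move: v; apply: linear_cV_ext => i.
rewrite f1E f2E /= lincomb_delta; have [t ->] := hx i.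
rewrite !tmap_tmap //; last exact: linear_comp.
by congr tmap; apply/funext => u; rewrite pK.
Qed.

(** Induction on the dimension n of a stable subspace, spanned by a free family x. If
    it is not irreducible, local finiteness applied inside the image of a proper nonzero
    subrepresentation F1 gives a stable free family of size m. If m < n the induction
    goes on; otherwise F1 contains n independent vectors of k^n and is not proper. *)
Lemma irreducible_sub E (rho : repr_of G E) (F : set E) e : subrep rho F -> F e -> e != 0 ->
  exists n (x : 'I_n -> E) (rho' : repr_of G 'cV[k]_n),
    [/\ lin_free x, forall i, F (x i), equivariant rho' rho (lincomb x) & irreducible rho'].
Proof.
move=> sF Fe ne; have [n [x [n0 fx Fx hx]]] := local_finiteness sF Fe ne.
elim/ltn_ind: n => n ih in F {e Fe ne} sF x n0 fx Fx hx *.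
have [rho' er] := lincomb_repr fx hx.
have [irr|] := EM (irreducible rho'); first by exists n, x, rho'.
move=> /not_andP [/forallNP h|/existsNP [F1 /not_implyP [sF1 /not_orP [F10 F1T]]]].
  case: (h (const_mx 1)); apply/eqP => /colP /(_ (Ordinal n0)) /eqP.
  by rewrite !mxE oner_eq0.
have [f Ff nf] : exists2 f, F1 f & f != 0.
  apply: contrapT => h; apply: F10; apply/seteqP; split=> u.
    by move=> F1u /=; apply: contrapT => /eqP nu; apply: h; exists u.
  by move=> ->; case: sF1 => [[]].
have sD := image_subrep er sF1.
have nxf : lincomb x f != 0.
  have [p pK] := lincomb_retract fx; apply/eqP => xf0.
  by case/eqP: nf; rewrite -[f]pK xf0 linear0.
have Dxf : (lincomb x @` F1)%classic (lincomb x f) by exists f.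
have [m [x' [m0 fx' Dx' hx']]] := local_finiteness sD Dxf nxf.
have [mn|nm] := ltnP m n.
  have [l [z [r [fz Fz ez irr]]]] := ih m mn _ sD x' m0 fx' Dx' hx'.
  exists l, z, r; split=> // i; have [u _ <-] := Fz i.
  by rewrite /lincomb; case: sF => sF _; apply: subspace_sum.
case: F1T; apply/seteqP; split=> // v _.
have /choice [g gE] : forall i, exists u, F1 u /\ lincomb x u = x' i.
  by move=> i; have [u F1u <-] := Dx' i; exists u.
pose B := \matrix_(i < m, j < n) g i j 0.
have BE (w : 'rV[k]_m) : (w *m B)^T = \sum_i w 0 i *: g i.
  apply/colP => j; rewrite !mxE summxE; apply: eq_bigr => i _.
  by rewrite !mxE.
have rB : row_free B.
  apply: inj_row_free => w wB; apply/rowP => i; rewrite mxE.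
  apply: (fx' (fun i => w 0 i)).
  under eq_bigr do rewrite -(gE _).2 -linearZ.
  by rewrite -linear_sum -BE wB trmx0 linear0.
have fB : row_full B.
  rewrite /row_full eqn_leq rank_leq_col (eqP rB); exact: nm.
have /submxP [w wE] : (v^T <= B)%MS by apply: submx_full.
rewrite -[v]trmxK wE BE; apply: subspace_sum => [|i]; first by case: sF1.
by case: (gE i).
Qed.

End Representations.

(** * The ring structure on the tensor square of A *)

Section TensorRing.
Context {k : fieldType} {A : comAlgType k}.
Implicit Types x y z : tensor A A.

Lemma mul_linear_l (b : A) : linear (fun a : A => a * b).
Proof. exact: (bilinear_mul A).1. Qed.

Lemma mul_linear_r (a : A) : linear (fun b : A => a * b).
Proof. exact: (bilinear_mul A).2. Qed.

Lemma tmul_bilinear_in (a a' : A) : is_bilinear (fun b b' : A => tpure (a * b) (a' * b')).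
Proof. by apply: tmap_bilinear; apply: mul_linear_r. Qed.

Lemma tmul_bilinear_out y :
  is_bilinear (fun a a' : A => tlift (fun b b' : A => tpure (a * b) (a' * b')) y).
Proof.
have [s ->] := tensor_sum y; have [t1 t2] := @tpure_bilinear k A A.
split=> [v|u] c a b; rewrite !(tlift_sum (tmul_bilinear_in _ _)) scaler_sumr -big_split.
  by apply: eq_bigr => p _ /=; rewrite mul_linear_l t1.
by apply: eq_bigr => p _ /=; rewrite mul_linear_l t2.
Qed.

Lemma tmul_linear_l y : linear ((@tmul k A)^~ y).
Proof. exact: (tlift_linear (tmul_bilinear_out y)). Qed.

Lemma tmul_tpure (a a' b b' : A) : tmul (tpure a a') (tpure b b') = tpure (a * b) (a' * b').
Proof.
by rewrite /tmul tlift_pure ?tlift_pure //; [exact: tmul_bilinear_in|exact: tmul_bilinear_out].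
Qed.

Lemma tmul_linear_r x : linear (tmul x).
Proof.
move=> c y z; move: x; apply: tensor_ext => [||a a'].
- exact: tmul_linear_l.
- by move=> d u v; rewrite !tmul_linear_l !scalerDr !scalerA mulrC addrACA.
rewrite /tmul !tlift_pure; [|exact: tmul_bilinear_out..].
by rewrite (tlift_linear (tmul_bilinear_in _ _)).
Qed.

Fact tmulA : associative (@tmul k A).
Proof.
move=> x y z; move: x; apply: tensor_ext => [||a a'].
- exact: tmul_linear_l.
- exact: (linear_comp (tmul_linear_l z) (tmul_linear_l y)).
move: y; apply: tensor_ext => [||b b'].
- exact: (linear_comp (tmul_linear_r _) (tmul_linear_l z)).
- exact: (linear_comp (tmul_linear_l z) (tmul_linear_r _)).
move: z; apply: tensor_ext => [||c c'].
- exact: (linear_comp (tmul_linear_r _) (tmul_linear_r _)).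
- exact: tmul_linear_r.
by rewrite !tmul_tpure !mulrA.
Qed.

Fact tmul1l : left_id (tpure 1 1) (@tmul k A).
Proof.
apply: tensor_ext => [||a a'] //; first exact: tmul_linear_r.
by rewrite tmul_tpure !mul1r.
Qed.

Fact tmul1r : right_id (tpure 1 1) (@tmul k A).
Proof.
apply: tensor_ext => [||a a'] //; first exact: tmul_linear_l.
by rewrite tmul_tpure !mulr1.
Qed.

Fact tmulDl : left_distributive (@tmul k A) +%R.
Proof. by move=> x y z; rewrite -[x]scale1r tmul_linear_l !scale1r. Qed.

Fact tmulDr : right_distributive (@tmul k A) +%R.
Proof. by move=> x y z; rewrite -[y]scale1r tmul_linear_r !scale1r. Qed.

HB.instance Definition _ := GRing.Zmodule_isPzRing.Build (tensor A A)
  tmulA tmul1l tmul1r tmulDl tmulDr.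

Lemma tpureM (a a' b b' : A) : tpure a a' * tpure b b' = tpure (a * b) (a' * b').
Proof. exact: tmul_tpure. Qed.

End TensorRing.

(** * Matrix coefficients and the Peter-Weyl theorem *)

Section Coefficients.
Context {k : fieldType} {A : comAlgType k} (G : affine_group A).

Lemma coord_bilinear (V : lmodType k) n (r : 'I_n) :
  is_bilinear (fun (e : 'cV[k]_n) (v : V) => e r 0 *: v).
Proof.
split=> [v|e] c x y; first by rewrite !mxE scalerDl scalerA.
by rewrite scalerDr !scalerA mulrC.
Qed.

(** Tensors with k^n are n-tuples. *)
Lemma tensor_cV (V : lmodType k) n (t : tensor 'cV[k]_n V) :
  t = \sum_r tpure (delta_mx r 0) (tlift (fun (e : 'cV[k]_n) (v : V) => e r 0 *: v) t).
Proof.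
have [t1 t2] := @tpure_bilinear k 'cV[k]_n V.
move: t; apply: tensor_ext => [//|c x y|e v].
  rewrite scaler_sumr -big_split; apply: eq_bigr => r _ /=.
  by rewrite (tlift_linear (coord_bilinear V r)) t2.
rewrite {1}(cV_sum e) (linear_sumE (t1 v)); apply: eq_bigr => r _.
rewrite tlift_pure; last exact: coord_bilinear.
by rewrite (linear_scaleE (t1 v)) (linear_scaleE (t2 _)).
Qed.

Lemma comul_mul (a b : A) : comul G (a * b) = comul G a * comul G b.
Proof. exact: comulM. Qed.

Section OneRepr.
Variables (n : nat) (rho : repr_of G 'cV[k]_n).
Local Notation M := (mxcoef rho).
Local Notation S := (antip G).

Lemma coact_delta s : coact rho (delta_mx s 0) = \sum_r tpure (delta_mx r 0) (M r s).
Proof.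
rewrite [LHS]tensor_cV; apply: eq_bigr => r _; congr tpure; by rewrite mxE.
Qed.

Lemma comul_mxcoef r s : comul G (M r s) = \sum_t tpure (M r t) (M t s).
Proof.
have bc := @coord_bilinear (tensor A A) n r.
have := congr1 (tlift (fun (e : 'cV[k]_n) (x : tensor A A) => e r 0 *: x))
  (coactA rho (delta_mx s 0)).
rewrite coact_delta !tmap_sum //; [|exact: linearP..].
rewrite (linear_sumE (@tassoc_linear k _ A A)) (linear_sumE (tlift_linear bc)).
rewrite (linear_sumE (tlift_linear bc)) [in RHS](bigD1 r) //= tlift_pure //.
rewrite mxE !eqxx scale1r [X in _ + X]big1 ?addr0; last first.
  by move=> i ne; rewrite tlift_pure // mxE eq_sym (negbTE ne) scale0r.
move=> <-; apply: eq_bigr => t _; rewrite coact_delta.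
have [t1 _] := @tpure_bilinear k (tensor 'cV[k]_n A) A.
rewrite (linear_sumE (t1 _)) (linear_sumE (@tassoc_linear k _ A A)).
rewrite (linear_sumE (tlift_linear bc)) (bigD1 r) //= tassoc_pure tlift_pure //.
rewrite mxE !eqxx scale1r big1 ?addr0 // => i ne.
by rewrite tassoc_pure tlift_pure // mxE eq_sym (negbTE ne) scale0r.
Qed.

Lemma counit_mxcoef r s : counit G (M r s) = (r == s)%:R.
Proof.
have := coact_counit rho (delta_mx s 0).
rewrite coact_delta (tlift_sum (counit_bilinear _ _)) => /colP /(_ r).
rewrite summxE (bigD1 r) //= big1 ?addr0 => [|i ne].
  by rewrite mxE [delta_mx r 0 r 0]mxE !eqxx mulr1 [RHS]mxE andbT => ->.
by rewrite mxE [delta_mx i 0 r 0]mxE eq_sym (negbTE ne) mulr0.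
Qed.

Lemma antip_mxcoefl : map_mx S M *m M = 1%:M.
Proof.
apply/matrixP => r s; rewrite [LHS]mxE [RHS]mxE.
under eq_bigr do rewrite [map_mx S M _ _]mxE.
have := antipl G (M r s).
rewrite comul_mxcoef tlift_sum; last first.
  apply: (@bilinear_comp k A A A A A (fun x y : A => x * y) S (fun y => y)) => //.
    exact: bilinear_mul.
  exact: linearP.
rewrite counit_mxcoef => h; apply: etrans h _.
by case: eqP => _; rewrite ?scale1r ?scale0r.
Qed.

Lemma antip_mxcoefl_sum l q : \sum_j S (M l j) * M j q = (l == q)%:R.
Proof.
have /matrixP /(_ l q) := antip_mxcoefl.
rewrite [X in X = _ -> _]mxE [X in _ = X -> _]mxE => <-.
by apply: eq_bigr => j _; rewrite [map_mx S M _ _]mxE.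
Qed.

Lemma antip_mxcoefr : M *m map_mx S M = 1%:M.
Proof.
apply/matrixP => r s; rewrite [LHS]mxE [RHS]mxE.
under eq_bigr do rewrite [map_mx S M _ _]mxE.
have := antipr G (M r s).
rewrite comul_mxcoef tlift_sum; last first.
  apply: (@bilinear_comp k A A A A A (fun x y : A => x * y) (fun y => y) S) => //.
    exact: bilinear_mul.
  exact: linearP.
rewrite counit_mxcoef => h; apply: etrans h _.
by case: eqP => _; rewrite ?scale1r ?scale0r.
Qed.

(** S (M) is inverse to M, and S is a ring morphism, so S (S (M)) is inverse to S (M). *)
Lemma antip_antip_mxcoef r s : S (S (M r s)) = M r s.
Proof.
have h : map_mx S (map_mx S M) *m map_mx S M = 1%:M.
  by rewrite -map_mxM antip_mxcoefl map_mx1.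
have : map_mx S (map_mx S M) = M.
  by rewrite -[LHS]mulmx1 -antip_mxcoefl mulmxA h mul1mx.
by move=> /matrixP /(_ r s); rewrite mxE [map_mx S M _ _]mxE.
Qed.

(** The coproduct is a ring morphism into A (x) A, so the coproduct of the matrix
    S (M) is the inverse of the coproduct of M; the right-hand side below is
    another inverse. *)
Lemma comul_antip_mxcoef t u : comul G (S (M t u)) = \sum_v tpure (S (M v u)) (S (M t v)).
Proof.
pose X : 'M[tensor A A]_n := map_mx (comul G) M.
pose Y : 'M[tensor A A]_n := map_mx (comul G) (map_mx S M).
pose Z : 'M[tensor A A]_n := \matrix_(t, u) \sum_v tpure (S (M v u)) (S (M t v)).
have XY : X *m Y = 1%:M.
  apply/matrixP => i j; rewrite [LHS]mxE [RHS]mxE.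
  transitivity (comul G (\sum_v M i v * S (M v j))).
    rewrite linear_sum; apply: eq_bigr => v _.
    by rewrite [X i v]mxE [Y v j]mxE [map_mx S M v j]mxE comul_mul.
  have /matrixP /(_ i j) := antip_mxcoefr; rewrite [X in X = _]mxE [X in _ = X]mxE.
  under eq_bigr do rewrite [map_mx S M _ _]mxE.
  by move=> ->; case: eqP => _; rewrite ?linear0 // comul1.
have ZX : Z *m X = 1%:M.
  apply/matrixP => i w; rewrite mxE.
  transitivity (\sum_v \sum_q \sum_j tpure (S (M v j) * M j q) (S (M i v) * M q w)).
    transitivity (\sum_j \sum_v \sum_q tpure (S (M v j) * M j q) (S (M i v) * M q w)).
      apply: eq_bigr => j _; rewrite [Z i j]mxE [X j w]mxE comul_mxcoef mulr_suml.
      by apply: eq_bigr => v _; rewrite mulr_sumr; apply: eq_bigr => q _; rewrite tpureM.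
    by rewrite exchange_big; apply: eq_bigr => v _; rewrite exchange_big.
  have [t1 t2] := @tpure_bilinear k A A.
  transitivity (\sum_v tpure (1 : A) (S (M i v) * M v w)); last first.
    rewrite -(linear_sumE (t2 (1 : A))) antip_mxcoefl_sum [RHS]mxE.
    by case: eqP => _ //; rewrite (linear_0E (t2 (1 : A))).
  apply: eq_bigr => v _; under eq_bigr do rewrite -(linear_sumE (t1 _)).
  rewrite (bigD1 v) //= antip_mxcoefl_sum eqxx big1 ?addr0 // => q ne.
  by rewrite antip_mxcoefl_sum eq_sym (negbTE ne) (linear_0E (t1 _)).
have : Y = Z by rewrite -[Y]mul1mx -ZX -mulmxA XY mulmx1.
by move=> /matrixP /(_ t u); rewrite [Y t u]mxE [Z t u]mxE [map_mx S M t u]mxE.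
Qed.

End OneRepr.

Definition regular_repr : repr_of G A := Repr (@comulA _ _ G) (@counitr _ _ G).

(** The span as an intersection of subspaces: linear properties of matrix coefficients
    then extend to it without handling combinations. *)
Definition coef_span (Ghat : dual_set G) : set A :=
  [set a | forall Q : set A, subspace Q ->
     (forall (i : Ghat) r s, Q (mxcoef (irrep i) r s)) -> Q a]%classic.

Lemma coef_span_subspace (Ghat : dual_set G) : subspace (coef_span Ghat).
Proof.
split=> [Q [] //|c u v hu hv Q sQ hQ].
by case: (sQ) => _; apply; [apply: hu|apply: hv].
Qed.

Lemma coef_span_mxcoef (Ghat : dual_set G) (i : Ghat) r s :
  coef_span Ghat (mxcoef (irrep i) r s).
Proof. by move=> Q _. Qed.

Lemma coef_span_subrep (Ghat : dual_set G) : subrep regular_repr (coef_span Ghat).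
Proof.
split=> [|a aS /=]; first exact: coef_span_subspace.
have [t1 _] := @tpure_bilinear k A A.
apply: (aS (fun a => exists s : seq (A * A), (forall p, p \in s -> coef_span Ghat p.1) /\
   comul G a = \sum_(p <- s) tpure p.1 p.2)) => [|i r s].
  split=> [|c u v [s [hs es]] [s' [hs' es']]].
    by exists [::]; rewrite big_nil linear0.
  exists ([seq (c *: p.1, p.2) | p <- s] ++ s'); split=> [p|].
    rewrite mem_cat => /orP [/mapP [q qs ->]|/hs' //] /=.
    have [S0 SL] := coef_span_subspace Ghat.
    by rewrite -[_ *: _]addr0; apply: SL => //; apply: hs.
  rewrite linearP es es' big_cat big_map scaler_sumr; congr (_ + _).
  by apply: eq_bigr => p _; rewrite (linear_scaleE (t1 _)).
exists [seq (mxcoef (irrep i) r t, mxcoef (irrep i) t s) | t <- enum 'I_(Defs.dim i)]; split.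
  by move=> _ /mapP [t _ ->]; apply: coef_span_mxcoef.
by rewrite comul_mxcoef big_map big_enum.
Qed.

(** Stated as an induction principle: a linear property of the coefficients of the
    irreducible representations holds on all of A. *)
Lemma peter_weyl (Ghat : dual_set G) (Q : set A) : linearly_semisimple G -> subspace Q ->
  (forall (i : Ghat) r s, Q (mxcoef (irrep i) r s)) -> forall a, Q a.
Proof.
move=> ss sQ hQ; suff PW a : coef_span Ghat a by move=> a; apply: PW.
move: a; have [C [sC I0 dec]] := ss _ _ _ (coef_span_subrep Ghat).
suff C0 c : C c -> c = 0.
  by move=> a; have [u [v [hu /C0 -> ->]]] := dec a; rewrite addr0.
move=> Cc; apply: contrapT => /eqP nc.
have [n [x [rho [fx Cx ex irr]]]] := irreducible_sub sC Cc nc.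
have [i [f [[g fK gK] ef]]] := irrep_full Ghat irr.
(* E_i is isomorphic to the span of x, and x_s = sum_r counit (x_r) M_rs, so x_s is a
   combination of coefficients of E_i. *)
suff x0 s : x s = 0.
  have /(_ (fun=> 1) _ (Ordinal (irreducible_dim_gt0 irr)))/eqP := fx; rewrite oner_eq0 => h; apply/notF/h.
  by rewrite big1 // => j _; rewrite x0 scaler0.
have : (coef_span Ghat `&` C)%classic (x s); last by rewrite I0.
split=> //.
have lg : linear g by move=> d u v; apply: (can_inj fK); rewrite linearP !gK.
have lx := linearP (lincomb x); have lf := linearP f.
pose b (e : 'cV[k]_n) (a : A) : A := (counit G (lincomb x e) : k) *: a.
have bb : is_bilinear b by apply: bilinear_functional_l => d u v; rewrite !linearP.
have -> : x s = tlift b (coact rho (delta_mx s 0)).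
  have := counitl G (x s); rewrite -{1}(lincomb_delta x) (ex (delta_mx s 0)) => <-.
  rewrite tlift_tmap //.
  exact/bilinear_functional_l/linearP.
have -> : coact rho (delta_mx s 0) = tmap g id (coact (irrep i) (f (delta_mx s 0))).
  rewrite ef tmap_tmap // -[LHS]tmap_id; congr tmap.
  by apply/funext => u; rewrite fK.
rewrite (cV_sum (f _)) linear_sum (linear_sumE (tmap_linear lg (@linear_id k A))).
rewrite (linear_sumE (tlift_linear bb)).
under eq_bigr do rewrite linearZ /= (linear_scaleE (tmap_linear lg (@linear_id k A)))
  (linear_scaleE (tlift_linear bb)).
apply: (subspace_sum (coef_span_subspace Ghat)) => j.
rewrite coact_delta tmap_sum // tlift_sum // /b.
by apply: (subspace_sum (coef_span_subspace Ghat)) => l; apply: coef_span_mxcoef.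
Qed.

End Coefficients.

(** * Invariant integral and Schur orthogonality *)

(** Left multiplication by W acts on the n columns of a matrix separately. *)
Lemma mxtrace_lin_mulmx (R : comPzRingType) n (W : 'M[R]_n) :
  \tr (lin_mulmx W : 'M[R]_(n * n)) = \tr W *+ n.
Proof.
rewrite /mxtrace (reindex _ (curry_mxvec_bij _ _)) /=.
transitivity (\sum_(i < n) \sum_(j < n) W i i); last first.
  by rewrite -sumrMnl; apply: eq_bigr => i _; rewrite sumr_const card_ord.
rewrite pair_bigA /=; apply: eq_bigr => -[i j] _ /=.
rewrite !mxE /= vec_mx_delta mxvecE mxE (bigD1 i) //= mxE !eqxx mulr1 big1 ?addr0 // => l ne.
by rewrite mxE (negbTE ne) mulr0.
Qed.

Section MatrixSchur.
Context {k : fieldType} {A : comAlgType k} (G : affine_group A).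

Lemma mulmx_equivariant m n (sigma : repr_of G 'cV[k]_m) (rho : repr_of G 'cV[k]_n) (P : 'M[k]_(n, m)) :
  (forall r u, \sum_q P q u *: mxcoef rho r q = \sum_q P r q *: mxcoef sigma q u) ->
  equivariant sigma rho (mulmx P).
Proof.
move=> h; have lP := linearP (mulmx P : 'cV[k]_m -> 'cV[k]_n).
have [t1 t2] := @tpure_bilinear k 'cV[k]_n A.
have [f1 f1E] := linear_bundle (linear_comp (linearP (coact rho)) lP).
have [f2 f2E] := linear_bundle (linear_comp (tmap_linear lP (@linear_id k A)) (linearP (coact sigma))).
move=> e; rewrite -[LHS]f1E -[RHS]f2E; move: e; apply: linear_cV_ext => u.
rewrite f1E f2E /= coact_delta tmap_sum //.
have Pd q : P *m delta_mx q 0 = \sum_r P r q *: delta_mx r 0 :> 'cV[k]_n.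
  rewrite [LHS]cV_sum; apply: eq_bigr => r _; congr (_ *: _).
  by rewrite -colE mxE.
rewrite Pd linear_sum.
transitivity (\sum_r tpure (delta_mx r 0 : 'cV[k]_n) (\sum_q P q u *: mxcoef rho r q)).
  under eq_bigr do rewrite linearZ /= coact_delta scaler_sumr.
  rewrite exchange_big; apply: eq_bigr => r _ /=.
  by rewrite (linear_sumE (t2 _)); apply: eq_bigr => q _; rewrite (linear_scaleE (t2 _)).
transitivity (\sum_r \sum_q P r q *: tpure (delta_mx r 0 : 'cV[k]_n) (mxcoef sigma q u)).
  apply: eq_bigr => r _; rewrite h (linear_sumE (t2 _)).
  by apply: eq_bigr => q _; rewrite (linear_scaleE (t2 _)).
rewrite exchange_big; apply: eq_bigr => q _ /=.
rewrite Pd (linear_sumE (t1 _)); apply: eq_bigr => r _.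
by rewrite (linear_scaleE (t1 _)).
Qed.

End MatrixSchur.

Section ClosedSchur.
Context {k : closedFieldType} {A : comAlgType k} (G : affine_group A).

(** P has an eigenvalue c, and P - c is an equivariant map that is not injective. *)
Lemma schur_scalar n (rho : repr_of G 'cV[k]_n) (P : 'M[k]_n) : irreducible rho ->
  (forall r u, \sum_q P q u *: mxcoef rho r q = \sum_q P r q *: mxcoef rho q u) ->
  exists c, P = c%:M.
Proof.
move=> irr h.
have n0 := irreducible_dim_gt0 irr.
have [c] : exists c, root (char_poly P^T) c.
  by apply/closed_rootP; rewrite size_char_poly eqSS -lt0n.
rewrite -eigenvalue_root_char => /eigenvalueP [v vP nv]; exists c.
have [|f0|[g gK _]] := schur (f := mulmx (P - c%:M)) irr irr.
- apply: mulmx_equivariant => r u.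
  have PE i j : (P - c%:M) i j = P i j - c *+ (i == j) by rewrite !mxE.
  under eq_bigr do rewrite PE scalerBl; under [RHS]eq_bigr do rewrite PE scalerBl.
  rewrite !sumrB h; congr (_ - _).
  rewrite (bigD1 u) //= eqxx [RHS](bigD1 r) //= eqxx !big1 ?addr0 // => q ne.
    by rewrite eq_sym (negbTE ne) scale0r.
  by rewrite (negbTE ne) scale0r.
- apply/eqP; rewrite -subr_eq0; apply/eqP/matrixP => i j.
  by have := f0 (delta_mx j 0); rewrite /= -colE => /colP /(_ i); rewrite !mxE.
case/eqP: nv; apply: trmx_inj; apply: (can_inj gK).
rewrite /= trmx0 mulmx0 mulmxBl mul_scalar_mx.
by rewrite -[P]trmxK -trmx_mul vP linearZ subrr.
Qed.

End ClosedSchur.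

Section Integral.
Context {k : fieldType} {A : comAlgType k} (G : affine_group A).
Variables (w : {linear A -> k^o}) (w_int : invariant_integral G w).
Local Notation S := (antip G).

(** The invariance of w under the universal point, the identity of A. *)
Lemma integral_invar (I : finType) (x y : I -> A) b :
  comul G b = \sum_i tpure (x i) (y i) -> \sum_i (w (y i) : k) *: x i = (w b : k)%:A.
Proof.
move=> hb; have := w_int.2 _ (idfun : {lrmorphism A -> A}) b.
rewrite /conv hb tlift_sum => [h|].
  by apply: etrans h; apply: eq_bigr => i _; rewrite /= /dext mulr_algr.
apply: (@bilinear_comp k A A A A A (fun x y : A => x * y) (fun x => x) (dext w)) => //.
  exact: bilinear_mul.
exact: linearP.
Qed.

(** Let W = w (M) and W' = w (S (M)). Applying w o S to the invariance of w at M gives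
    W' W = W; applying it to the invariance of w at S (M) gives W' W = W'. *)
Lemma integral_antip (Ghat : dual_set G) : linearly_semisimple G -> forall a, w (S a) = w a.
Proof.
move=> ss; apply: (peter_weyl (Ghat := Ghat) (Q := fun a => w (S a) = w a) ss) => [|i r s].
  by split=> [|c u v hu hv]; rewrite ?linear0 // !linearP hu hv.
set M := mxcoef (irrep i).
have e1 : \sum_t (w (M t s) : k) *: M r t = (w (M r s) : k)%:A.
  by apply: integral_invar; apply: comul_mxcoef.
have e2 : \sum_t (w (S (M r t)) : k) *: S (M t s) = (w (S (M r s)) : k)%:A.
  by apply: integral_invar; apply: comul_antip_mxcoef.
have := congr1 (w \o S) e1; have := congr1 (w \o S) e2.
rewrite /= !linear_sum !linearZ /= !rmorph1 w_int.1 ![_ *: 1]mulr1 => <- <-.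
apply: eq_bigr => t _; rewrite !linearZ /= antip_antip_mxcoef.
exact: mulrC.
Qed.

(** Left invariance says that the matrix P of averages satisfies rho P S(sigma) = P over A;
    multiply by sigma on the right. *)
Lemma average_intertwines m n (sigma : repr_of G 'cV[k]_m) (rho : repr_of G 'cV[k]_n) s t :
  let P r u : k := w (mxcoef rho r s * S (mxcoef sigma t u)) in
  forall r u, \sum_q P q u *: mxcoef rho r q = \sum_q P r q *: mxcoef sigma q u.
Proof.
move=> P r u.
have inv u' : \sum_(p : 'I_n * 'I_m) P p.1 p.2 *: (mxcoef rho r p.1 * S (mxcoef sigma p.2 u')) =
    (P r u')%:A.
  apply: integral_invar; rewrite comul_mul comul_mxcoef comul_antip_mxcoef mulr_suml.
  under eq_bigr do rewrite mulr_sumr.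
  by rewrite pair_bigA; apply: eq_bigr => p _; rewrite tpureM.
transitivity (\sum_u' (P r u')%:A * mxcoef sigma u' u); last first.
  by apply: eq_bigr => q _; rewrite mulr_algl.
under [RHS]eq_bigr do rewrite -inv mulr_suml.
rewrite exchange_big.
transitivity (\sum_q \sum_v P q v *: (mxcoef rho r q * (v == u)%:R)).
  apply: eq_bigr => q _; rewrite (bigD1 u) //= eqxx mulr1 big1 ?addr0 // => v ne.
  by rewrite (negbTE ne) mulr0 scaler0.
rewrite [LHS]pair_bigA; apply: eq_bigr => p _ /=.
rewrite -(antip_mxcoefl_sum sigma) mulr_sumr scaler_sumr; apply: eq_bigr => j _.
by rewrite -scalerAl mulrA.
Qed.

End Integral.

(** * Fourier inversion *)

Section DualInt.
Context {k : fieldType} {A : comAlgType k} (G : affine_group A) {B : comAlgType k}.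
Variable Ghat : dual_set G.
Implicit Types u v : {linear A -> B}.

Lemma dual_tr_conv u v :
  dual_tr Ghat (conv G u v) = dual_int (fun i : Ghat => dcomp u i *m dcomp v i).
Proof.
apply: eq_fsbigr => i _; congr (\tr (lin_mulmx _)).
apply/matrixP => r s; rewrite mxE [RHS]mxE.
have bb : is_bilinear (fun x y : A => u x * v y).
  apply: (@bilinear_comp k A A B B B (fun x y : B => x * y) u v); first exact: bilinear_mul.
    exact: linearP.
  exact: linearP.
rewrite -[LHS]/(tlift (fun x y : A => u x * v y) (comul G (mxcoef (irrep i) r s))).
rewrite comul_mxcoef tlift_sum //.
by apply: eq_bigr => t _; rewrite [dcomp u i r t]mxE [dcomp v i t s]mxE.
Qed.

Lemma dual_int_dcomp u v : dual_int (fun i : Ghat => dcomp u i *m dcomp v i) =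
  \sum_(i \in [set: Ghat])
    (\sum_r \sum_s u (mxcoef (irrep i) r s) * v (mxcoef (irrep i) s r)) *+ dim i.
Proof.
apply: eq_fsbigr => i _; rewrite mxtrace_lin_mulmx; congr (_ *+ _).
apply: eq_bigr => r _; rewrite mxE; apply: eq_bigr => s _.
by rewrite [dcomp u i r s]mxE [dcomp v i s r]mxE.
Qed.

End DualInt.

Section Inversion.
Context {k : closedFieldType} {A : comAlgType k} (G : affine_group A).
Variables (Gss : linearly_semisimple G) (Ghat : dual_set G).
Variables (w : {linear A -> k^o}) (w_int : invariant_integral G w).
Local Notation S := (antip G).
Local Notation M i := (mxcoef (irrep (d := Ghat) i)).

Lemma orthogonality_neq (i j : Ghat) r s t u : i != j -> w (M i r s * S (M j t u)) = 0.
Proof.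
move=> ne; pose P := \matrix_(r, u) (w (M i r s * S (M j t u)) : k).
have eP : equivariant (irrep j) (irrep i) (mulmx P).
  apply: mulmx_equivariant => r' u'.
  under eq_bigr do rewrite [P _ _]mxE; under [RHS]eq_bigr do rewrite [P _ _]mxE.
  exact: (average_intertwines w_int (irrep j) (irrep i) s t).
have [f0|bij] := schur (irrep_irreducible j) (irrep_irreducible i) eP.
  by have := f0 (delta_mx u 0); rewrite /= -colE => /colP /(_ r); rewrite mxE mxE [RHS]mxE.
by case/eqP: ne; apply/esym/irrep_inj; exists (mulmx P).
Qed.

(** The average is a scalar matrix c; its trace d_i c is w of an entry of S (M_i) M_i = 1.
    Multiplying by d_i avoids dividing before d_i is known to be nonzero in k. *)
Lemma orthogonality_eq (i : Ghat) r s t u :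
  (w (M i r s * S (M i t u)) : k) *+ dim i = (r == u)%:R * (s == t)%:R.
Proof.
have scal s' t' : exists c : k, forall r u,
    w (M i r s' * S (M i t' u)) = c *+ (r == u) /\ c *+ dim i = (s' == t')%:R.
  pose P := \matrix_(r, u) (w (M i r s' * S (M i t' u)) : k).
  have [|c cP] := schur_scalar (P := P) (irrep_irreducible i).
    move=> r' u'.
    under eq_bigr do rewrite [P _ _]mxE; under [RHS]eq_bigr do rewrite [P _ _]mxE.
    exact: (average_intertwines w_int (irrep i) (irrep i) s' t').
  exists c => r' u'.
  have wc r1 u1 : w (M i r1 s' * S (M i t' u1)) = c *+ (r1 == u1).
    by have /matrixP /(_ r1 u1) := cP; rewrite mxE [RHS]mxE.
  split=> //.
  transitivity (\sum_r1 w (M i r1 s' * S (M i t' r1))).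
    under eq_bigr do rewrite wc eqxx.
    by rewrite sumr_const card_ord.
  rewrite -linear_sum; under eq_bigr do rewrite mulrC.
  rewrite antip_mxcoefl_sum eq_sym; case: eqP => _; last by rewrite linear0.
  exact: w_int.1.
have [c] := scal s t; move=> /(_ r u) [-> cd].
by rewrite mulrnAC cd mulr_natl.
Qed.

(** By linearity a is a coefficient of some E_j, and then only the component j survives. *)
Lemma fourier_support (a : A) : exists D : {fset Ghat},
  forall i, i \notin D -> forall r s, w (S a * M i r s) = 0.
Proof.
move: a; apply: (peter_weyl (Ghat := Ghat) Gss) => [|j t u].
  split=> [|c a b [D hD] [D' hD']].
    by exists fset0 => i _ r s; rewrite linear0 mul0r linear0.
  exists (D `|` D')%fset => i; rewrite in_fsetU negb_or => /andP [iD iD'] r s.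
  by rewrite linearP mulrDl -scalerAl linearP hD // hD' // scaler0 addr0.
exists [fset j]%fset => i; rewrite in_fset1 => ne r s.
by rewrite mulrC orthogonality_neq.
Qed.

(** The map v is the extension of scalars of F(a). It is given by its values in order to
    cover both the transform itself, over k and over B, and the dual of a transform. *)
Lemma fourier_inversion (B : comAlgType k) (u v : {linear A -> B}) a :
  (forall x, v x = (w (S a * x) : k)%:A) ->
  dual_int (fun i : Ghat => dcomp v i *m dcomp u i) = u a.
Proof.
pose T a i := (\sum_r \sum_s (w (S a * M i r s) : k) *: u (M i s r)) *+ dim i.
move=> vE; rewrite dual_int_dcomp.
transitivity (\sum_(i \in [set: Ghat]) T a i).
  apply: eq_fsbigr => i _; congr (_ *+ _); apply: eq_bigr => r _; apply: eq_bigr => s _.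
  by rewrite vE mulr_algl.
have T0 b (D : {fset Ghat}) : (forall i, i \notin D -> forall r s, w (S b * M i r s) = 0) ->
    forall i, i \notin D -> T b i = 0.
  move=> hD i iD; rewrite /T big1 ?mul0rn // => r _; rewrite big1 // => s _.
  by rewrite hD // scale0r.
move: {v vE} a; apply: (peter_weyl (Ghat := Ghat) Gss) => [|j t q].
  split=> [|c a b ha hb].
    rewrite (@fsbigTE _ _ _ _ fset0) ?big_seq_fset0 ?linear0 // => i _.
    rewrite /T big1 ?mul0rn // => r _; rewrite big1 // => s _.
    by rewrite linear0 mul0r linear0 scale0r.
  have [D hD] := fourier_support a; have [D' hD'] := fourier_support b.
  have TL i : T (c *: a + b) i = c *: T a i + T b i.
    rewrite /T -scalerMnr -mulrnDl; congr (_ *+ _); rewrite scaler_sumr -big_split.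
    apply: eq_bigr => r _; rewrite scaler_sumr -big_split; apply: eq_bigr => s _ /=.
    by rewrite linearP mulrDl -scalerAl linearP scalerDl scalerA.
  have Ta : forall i, i \notin (D `|` D')%fset -> T a i = 0.
    by move=> i; rewrite in_fsetU negb_or => /andP [iD _]; apply: (T0 _ D).
  have Tb : forall i, i \notin (D `|` D')%fset -> T b i = 0.
    by move=> i; rewrite in_fsetU negb_or => /andP [_ iD]; apply: (T0 _ D').
  rewrite linearP -ha -hb !(@fsbigTE _ _ _ _ (D `|` D')%fset) //; last first.
    by move=> i iD; rewrite TL Ta // Tb // scaler0 addr0.
  by rewrite scaler_sumr -big_split; apply: eq_bigr => i _; rewrite TL.
have d0 : ((dim j)%:R : k) != 0.
  apply/negP => /eqP d0; have := orthogonality_eq t t t t.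
  rewrite !eqxx mulr1 -[X in X = _ -> _]mulr_natr d0 mulr0 => /esym/eqP.
  by rewrite oner_eq0.
have orth r s : (w (S (M j t q) * M j r s) : k) = (r == q)%:R * (s == t)%:R / (dim j)%:R.
  by rewrite mulrC -orthogonality_eq -[X in _ = X / _]mulr_natr mulfK.
rewrite (@fsbigTE _ _ _ _ [fset j]%fset); last first.
  apply: T0 => i; rewrite in_fset1 => ne r s.
  by rewrite mulrC orthogonality_neq.
rewrite big_seq_fset1 /T (bigD1 q) //= [X in _ + X]big1 ?addr0 => [|r ne]; last first.
  by rewrite big1 // => s _; rewrite orth (negbTE ne) !mul0r scale0r.
rewrite (bigD1 t) //= [X in _ + X]big1 ?addr0 => [|s ne]; last first.
  by rewrite orth (negbTE ne) mulr0 mul0r scale0r.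
by rewrite orth !eqxx !mul1r -scaler_nat scalerA mulfV // scale1r.
Qed.

Lemma antip_antip a : S (S a) = a.
Proof.
move: a; apply: (peter_weyl (Ghat := Ghat) Gss) => [|i r s]; last exact: antip_antip_mxcoef.
split=> [|c u v hu hv]; first by rewrite !linear0.
by rewrite -[RHS](congr2 (fun x y => c *: x + y) hu hv) !linearP.
Qed.

(** The involution of the dual algebra maps F(a) to F(S(a)). *)
Lemma dstar_fourier a x : w (S a * S x) = w (S (S a) * x).
Proof. by rewrite -rmorphM (integral_antip w_int Ghat Gss) antip_antip. Qed.

(** By inversion S(a) has the property that characterizes the transform, and linear forms
    separate the elements of A. *)
Lemma dual_fourier_fourier a : dual_fourier Ghat (fourier G w a) = S a.
Proof.
have hS (w' : {linear A -> k^o}) : w' (S a) = dual_tr Ghat (conv G (dstar G (fourier G w a)) w').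
  rewrite dual_tr_conv (@fourier_inversion _ _ _ (S a)) // => x.
  by rewrite -dstar_fourier [RHS]mulr1.
rewrite /dual_fourier; case: xgetP => [b _ hb|/(_ (S a))]; last by case.
have e (w' : {linear A -> k^o}) : w' (b - S a) = 0 by rewrite linearB hb hS subrr.
apply/eqP; rewrite -subr_eq0; apply/eqP; set c := b - S a in e *.
have [//|nc] := EM (c = 0).
have [||f [_ fc]] := @functional_sep k A [set 0]%classic c.
- by split=> // d x y -> ->; rewrite scaler0 addr0.
- by [].
by have /eqP := e f; rewrite fc oner_eq0.
Qed.

End Inversion.

Theorem mainTheorem5 (k : closedFieldType) (A : comAlgType k) (G : affine_group A)
    (Gss : linearly_semisimple G) (Ghat : dual_set G)
    (wG : {linear A -> k^o}) (wG_int : invariant_integral G wG) (a : A) :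
  in_Atilde Ghat (fourier G wG a) /\
  forall (B : comAlgType k) (g : {lrmorphism A -> B}),
    [/\ g a = dstar G g (antip G a),
        dstar G g (antip G a) = dstar G g (dual_fourier Ghat (fourier G wG a)),
        dstar G g (dual_fourier Ghat (fourier G wG a)) =
          dual_tr Ghat (conv G (dext (dstar G (fourier G wG a))) (dstar G g)) &
        dual_tr Ghat (conv G (dext (dstar G (fourier G wG a))) (dstar G g)) =
          dual_int (fun i : Ghat => dcomp (dext (fourier G wG a)) i *m dcomp g i)].
Proof.
split.
  have [D hD] := fourier_support Gss Ghat wG_int a.
  apply: (sub_finite_set _ (finite_fset D)) => i /= /eqP ne.
  apply: contrapT => /negP iD; apply: ne; apply/matrixP => r s.
  by rewrite mxE [RHS]mxE; apply: hD.
move=> B g.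
have dstarE x : dstar G g x = g (antip G x) by [].
have trE : dual_tr Ghat (conv G (dext (dstar G (fourier G wG a))) (dstar G g)) = g a.
  rewrite dual_tr_conv (@fourier_inversion _ _ _ Gss Ghat wG wG_int _ _ _ (antip G a)).
    by rewrite dstarE (antip_antip Gss Ghat).
  by move=> x; rewrite -(dstar_fourier Gss Ghat wG_int).
rewrite dual_fourier_fourier // trE dstarE (antip_antip Gss Ghat); split=> //.
apply: esym.
exact: (@fourier_inversion _ _ _ Gss Ghat wG wG_int B g (dext (fourier G wG a)) a (fun x => erefl)).
Qed.
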